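(* Let $({}_{f_2}M_1\times{}_{f_1}M_2,F)$ be a flat doubly warped product Finsler manifold. Then: (i) if $(M_1,F_1)$ is Riemannian, then the components of the Riemannian curvature of $M_1$ are $$R^{\ i}_{j\ kl}=\frac{\|\mathrm{grad} f_2\|^2}{f_1^2}\big(\delta^i_lg_{jk}-\delta^i_kg_{jl}\big);$$ (ii) if $(M_2,F_2)$ is Riemannian, then the components of the Riemannian curvature of $M_2$ are $$R^{\ \gamma}_{\alpha\ \beta\lambda}=\frac{\|\mathrm{grad} f_1\|^2}{f_2^2}\big(\delta^\gamma_\lambda g_{\alpha\beta}-\delta^\gamma_\beta g_{\alpha\lambda}\big).$$
   Context: A Finsler metric on a manifold $M$ is a function $F:TM\to[0,\infty)$ that is $C^\infty$ on the slit tangent bundle $TM^\circ$, positively $1$-homogeneous on fibres, and whose fibre Hessian of $\frac12F^2$ is positive definite. Let $(M_1,F_1)$, $(M_2,F_2)$ be Finsler manifolds and let $f_1:M_1\to\mathbb{R}^+$, $f_2:M_2\to\mathbb{R}^+$ be smooth (the warping functions). The doubly warped product Finsler manifold $({}_{f_2}M_1\times{}_{f_1}M_2,F)$ is $M=M_1\times M_2$ with $$F(v_1,v_2)=\sqrt{f_2^2(\pi_2(v_2))F_1^2(v_1)+f_1^2(\pi_1(v_1))F_2^2(v_2)},\qquad (v_1,v_2)\in TM^\circ:=TM_1^\circ\times TM_2^\circ,$$ where $\pi_1,\pi_2$ are the base-point projections; all objects are considered on $TM^\circ$. Local induced coordinates are $(x^i,y^i)$ on $TM_1$, $(u^\alpha,v^\alpha)$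 on $TM_2$, and $\mathbf{x}^a=(x^i,u^\alpha)$, $\mathbf{y}^a=(y^i,v^\alpha)$ on $TM$; repeated indices are summed. $g_{ij}=\frac12\frac{\partial^2F_1^2}{\partial y^i\partial y^j}$, $g_{\alpha\beta}=\frac12\frac{\partial^2F_2^2}{\partial v^\alpha\partial v^\beta}$, $\mathbf{g}_{ab}=\frac12\frac{\partial^2F^2}{\partial\mathbf{y}^a\partial\mathbf{y}^b}$, with inverses denoted by upper indices. Put $\mathbf{G}^a=\frac14\mathbf{g}^{ab}\big(\frac{\partial^2F^2}{\partial\mathbf{y}^b\partial\mathbf{x}^c}\mathbf{y}^c-\frac{\partial F^2}{\partial\mathbf{x}^b}\big)$, $\mathbf{G}^a_b=\frac{\partial\mathbf{G}^a}{\partial\mathbf{y}^b}$, $\frac{\delta^d}{\delta^d\mathbf{x}^a}=\frac{\partial}{\partial\mathbf{x}^a}-\mathbf{G}^b_a\frac{\partial}{\partial\mathbf{y}^b}$, $$\mathbf{F}^c_{ab}=\tfrac12\mathbf{g}^{ce}\Big(\frac{\delta^d\mathbf{g}_{ea}}{\delta^d\mathbf{x}^b}+\frac{\delta^d\mathbf{g}_{eb}}{\delta^d\mathbf{x}^a}-\frac{\delta^d\mathbf{g}_{ab}}{\delta^d\mathbf{x}^e}\Big).$$ The Riemannian curvature of $({}_{f_2}M_1\times{}_{f_1}M_2,F)$ is $$\mathbf{R}^{\ a}_{b\ cd}=\frac{\delta^d\mathbf{F}^a_{bc}}{\delta^d\mathbf{x}^d}-\frac{\delta^d\mathbf{F}^a_{bd}}{\delta^d\mathbf{x}^c}+\mathbf{F}^a_{de}\mathbf{F}^e_{bc}-\mathbf{F}^a_{ce}\mathbf{F}^e_{bd}$$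 (the superscript $d$ in $\delta^d$ is a label, not an index), and flat means $\mathbf{R}^{\ a}_{b\ cd}=0$. The curvatures $R^{\ i}_{j\ kl}$ of $M_1$ and $R^{\ \gamma}_{\alpha\ \beta\lambda}$ of $M_2$ are defined by the same formulas (with the same index and sign convention) from $F_1$ and from $F_2$; in the Riemannian case the corresponding $F^i_{jk}$ are the Christoffel symbols. A Finsler metric is Riemannian if and only if its fundamental tensor does not depend on the fibre coordinates. The norms are $\|\mathrm{grad} f_2\|^2=g^{\alpha\gamma}\frac{\partial f_2}{\partial u^\alpha}\frac{\partial f_2}{\partial u^\gamma}$ and $\|\mathrm{grad} f_1\|^2=g^{ij}\frac{\partial f_1}{\partial x^i}\frac{\partial f_1}{\partial x^j}$. *)

(* Defs.v *)
(* MathComp-Analysis *)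
From HB Require Import structures.
From mathcomp Require Import all_boot all_order all_algebra.
From mathcomp Require Import all_classical all_reals all_analysis.
Set Implicit Arguments.
Unset Strict Implicit.
Unset Printing Implicit Defensive.
Import Order.TTheory GRing.Theory Num.Theory.
Import numFieldNormedType.Exports.
Local Open Scope classical_set_scope.
Local Open Scope ring_scope.

(* For finite-dimensional V and open U this is C^k on U in the usual sense:
   'D_v ranges over all directions, in particular over the partial derivatives. *)
Fixpoint Ck_on (R : realType) (V W : normedModType R) (k : nat) (U : set V)
    (f : V -> W) : Prop :=
  match k with
  | 0 => forall x, U x -> {for x, continuous f}
  | k'.+1 => (forall x, U x -> differentiable f x) /\
             (forall v : V, Ck_on k' U ('D_v f))
  end.

Definition smooth_on (R : realType) (V W : normedModType R) (U : set V)
    (f : V -> W) : Prop := forall k, Ck_on k U f.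

(* [cmap] and [cinv] are total; they carry information only on [cdom], [cimg]. *)
Record chart (R : realType) (T : topologicalType) (n : nat) := Chart {
  cdom : set T;
  cimg : set 'rV[R]_n;
  cmap : T -> 'rV[R]_n;
  cinv : 'rV[R]_n -> T;
  cdom_open : open cdom;
  cimg_open : open cimg;
  cmap_img : forall p, cdom p -> cimg (cmap p);
  cinv_dom : forall x, cimg x -> cdom (cinv x);
  cmapK : forall p, cdom p -> cinv (cmap p) = p;
  cinvK : forall x, cimg x -> cmap (cinv x) = x;
  cmap_continuous : {within cdom, continuous cmap};
  cinv_continuous : {within cimg, continuous cinv}
}.

(* The atlas is any atlas of the smooth structure, not necessarily maximal. *)
Record manifold (R : realType) (n : nat) := Manifold {
  mcarrier :> topologicalType;
  m_hausdorff : hausdorff_space mcarrier;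
  m_second_countable : @second_countable mcarrier;
  mindex : Type;
  atlas : mindex -> chart R mcarrier n;
  atlas_cover : forall p, exists i, cdom (atlas i) p;
  atlas_smooth : forall i j,
    smooth_on (cimg (atlas i) `&` cinv (atlas i) @^-1` cdom (atlas j))
              (cmap (atlas j) \o cinv (atlas i))
}.

Record smooth_fun (R : realType) (n : nat) (M : manifold R n) := SmoothFun {
  sfun :> M -> R;
  sfunP : forall i : mindex M,
    smooth_on (W := R^o) (cimg (atlas i)) (sfun \o cinv (atlas i))
}.

(* Tangent vectors at p are the derivations at p of the algebra of smooth
   functions; the third function h stands for a f + g, respectively f g. *)
Record tangent (R : realType) (n : nat) (M : manifold R n) (p : M) := Tangent {
  tfun :> smooth_fun M -> R;
  tfun_linear : forall (a : R) (f g h : smooth_fun M),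
    (forall q, h q = a * f q + g q) -> tfun h = a * tfun f + tfun g;
  tfun_leibniz : forall f g h : smooth_fun M,
    (forall q, h q = f q * g q) -> tfun h = f p * tfun g + g p * tfun f
}.

Section CoordinateVectors.
Variables (R : realType) (n : nat) (M : manifold R n) (i : mindex M).
Variables x y : 'rV[R]_n.

Definition coord_fun (f : smooth_fun M) : R :=
  if asbool (cimg (atlas i) x) then 'D_y (f \o cinv (atlas i) : _ -> R^o) x
  else 0.

Lemma smooth_fun_derivable (f : smooth_fun M) :
  cimg (atlas i) x -> derivable (f \o cinv (atlas i) : _ -> R^o) x y.
Proof.
move=> hx; apply: diff_derivable.
by have [+ _] := sfunP f i 1%N; apply.
Qed.

Lemma coord_fun_linear (a : R) (f g h : smooth_fun M) :
  (forall q, h q = a * f q + g q) -> coord_fun h = a * coord_fun f + coord_fun g.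
Proof.
move=> hE; rewrite /coord_fun; case: asboolP => hx; last by rewrite mulr0 addr0.
have df := smooth_fun_derivable (f := f) hx; have dg := smooth_fun_derivable (f := g) hx.
have -> : (h \o cinv (atlas i) : _ -> R^o) =
    (a \*: (f \o cinv (atlas i) : _ -> R^o)) + (g \o cinv (atlas i) : _ -> R^o).
  by apply/funext => z /=; rewrite hE.
by rewrite deriveD ?deriveZ //; exact: derivableZ.
Qed.

Lemma coord_fun_leibniz (f g h : smooth_fun M) :
  (forall q, h q = f q * g q) ->
  coord_fun h = f (cinv (atlas i) x) * coord_fun g
              + g (cinv (atlas i) x) * coord_fun f.
Proof.
move=> hE; rewrite /coord_fun; case: asboolP => hx;
  last by rewrite !mulr0 addr0.
have df := smooth_fun_derivable (f := f) hx; have dg := smooth_fun_derivable (f := g) hx.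
have -> : (h \o cinv (atlas i) : _ -> R^o) =
    (f \o cinv (atlas i) : _ -> R) * (g \o cinv (atlas i) : _ -> R).
  by apply/funext => z /=; rewrite hE.
by rewrite deriveM.
Qed.

(* The vector \sum_a y_a d/dx^a at the point with coordinates x in the i-th
   chart (and the zero vector when x is not in the range of the chart). *)
Definition coord_vect : tangent (cinv (atlas i) x) :=
  Tangent coord_fun_linear coord_fun_leibniz.

End CoordinateVectors.

Section LocalGeometry.
Variables (R : realType) (n : nat).

(* A function on TM in induced coordinates, (position, fibre) |-> value. *)
Local Notation fld := ('rV[R]_n -> 'rV[R]_n -> R).

Definition dpos (a : 'I_n) (h : fld) : fld :=
  fun x y => 'D_(delta_mx 0 a) (h ^~ y : _ -> R^o) x.

Definition dfib (a : 'I_n) (h : fld) : fld :=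
  fun x y => 'D_(delta_mx 0 a) (h x : _ -> R^o) y.

Definition sqr_fld (F : fld) : fld := fun x y => F x y ^+ 2.

Definition fund (F : fld) (a b : 'I_n) : fld :=
  fun x y => 2^-1 * dfib a (dfib b (sqr_fld F)) x y.

Definition fund_mx (F : fld) (x y : 'rV[R]_n) : 'M[R]_n :=
  \matrix_(a, b) fund F a b x y.

Definition fund_inv (F : fld) (a b : 'I_n) : fld :=
  fun x y => invmx (fund_mx F x y) a b.

Definition spray (F : fld) (a : 'I_n) : fld := fun x y =>
  4^-1 * \sum_b fund_inv F a b x y *
    (\sum_c dfib b (dpos c (sqr_fld F)) x y * y 0 c - dpos b (sqr_fld F) x y).

Definition nonlin_conn (F : fld) (a b : 'I_n) : fld := dfib b (spray F a).

Definition delta_d (F : fld) (a : 'I_n) (h : fld) : fld := fun x y =>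
  dpos a h x y - \sum_b nonlin_conn F b a x y * dfib b h x y.

(* F^c_{ab} *)
Definition lin_conn (F : fld) (c a b : 'I_n) : fld := fun x y =>
  2^-1 * \sum_e fund_inv F c e x y *
    (delta_d F b (fund F e a) x y + delta_d F a (fund F e b) x y
     - delta_d F e (fund F a b) x y).

(* R_b^a_{cd}, arguments in the order a b c d *)
Definition riem_curv (F : fld) (a b c d : 'I_n) : fld := fun x y =>
  delta_d F d (lin_conn F a b c) x y - delta_d F c (lin_conn F a b d) x y
  + \sum_e lin_conn F a d e x y * lin_conn F e b c x y
  - \sum_e lin_conn F a c e x y * lin_conn F e b d x y.

End LocalGeometry.

Definition in_coords (R : realType) (n : nat) (M : manifold R n)
    (F : forall p : M, tangent p -> R) (i : mindex M) (x y : 'rV[R]_n) : R :=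
  F _ (coord_vect i x y).

Record finsler (R : realType) (n : nat) (M : manifold R n) := Finsler {
  fnorm :> forall p : M, tangent p -> R;
  fnorm_ge0 : forall p (v : tangent p), 0 <= fnorm v;
  fnorm_smooth : forall i : mindex M,
    smooth_on (W := R^o)
      [set z : 'rV[R]_n * 'rV[R]_n | cimg (atlas i) z.1 /\ z.2 != 0]
      (fun z => in_coords fnorm i z.1 z.2);
  fnorm_homogeneous : forall p (v w : tangent p) (a : R), 0 < a ->
    (forall f, w f = a * v f) -> fnorm w = a * fnorm v;
  fnorm_posdef : forall (i : mindex M) (x y w : 'rV[R]_n),
    cimg (atlas i) x -> y != 0 -> w != 0 ->
    0 < (w *m fund_mx (in_coords fnorm i) x y *m w^T) 0 0
}.

Definition riemannian (R : realType) (n : nat) (M : manifold R n)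
    (F : finsler M) : Prop :=
  forall (i : mindex M) (x y y' : 'rV[R]_n),
    cimg (atlas i) x -> y != 0 -> y' != 0 ->
    fund_mx (in_coords F i) x y = fund_mx (in_coords F i) x y'.

Definition grad_norm2 (R : realType) (n : nat) (M : manifold R n)
    (F : finsler M) (f : smooth_fun M) (i : mindex M) (x y : 'rV[R]_n) : R :=
  \sum_a \sum_b fund_inv (in_coords F i) a b x y
    * 'D_(delta_mx 0 a) (f \o cinv (atlas i) : _ -> R^o) x
    * 'D_(delta_mx 0 b) (f \o cinv (atlas i) : _ -> R^o) x.

Section DoublyWarped.
Variables (R : realType) (n1 n2 : nat).
Variables (M1 : manifold R n1) (M2 : manifold R n2).
Variables (F1 : finsler M1) (F2 : finsler M2).
Variables (f1 : smooth_fun M1) (f2 : smooth_fun M2).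

Definition dwp (p1 : M1) (p2 : M2) (v1 : tangent p1) (v2 : tangent p2) : R :=
  Num.sqrt (f2 p2 ^+ 2 * F1 p1 v1 ^+ 2 + f1 p1 ^+ 2 * F2 p2 v2 ^+ 2).

(* Positions and fibre coordinates on the product are (x, u) and (y, v). *)
Definition dwp_coords (i1 : mindex M1) (i2 : mindex M2)
    (xu yv : 'rV[R]_(n1 + n2)) : R :=
  dwp (coord_vect i1 (lsubmx xu) (lsubmx yv))
      (coord_vect i2 (rsubmx xu) (rsubmx yv)).

Definition dwp_flat : Prop :=
  forall (i1 : mindex M1) (i2 : mindex M2) (x y : 'rV[R]_n1) (u v : 'rV[R]_n2),
    cimg (atlas i1) x -> cimg (atlas i2) u -> y != 0 -> v != 0 ->
    forall a b c d : 'I_(n1 + n2),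
      riem_curv (dwp_coords i1 i2) a b c d (row_mx x u) (row_mx y v) = 0.

End DoublyWarped.

(* Main.v *)
Require Import Defs.
From mathcomp Require Import all_boot all_order all_algebra.
From mathcomp Require Import all_classical all_reals all_analysis.
From mathcomp Require Import ring.
Set Implicit Arguments.
Unset Strict Implicit.
Unset Printing Implicit Defensive.
Import Order.TTheory GRing.Theory Num.Theory.
Import numFieldNormedType.Exports.
Local Open Scope classical_set_scope.
Local Open Scope ring_scope.

(* In the doubly warped product the fundamental tensor is block diagonal, with
   blocks f2^2 g_ij and f1^2 g_(alpha beta).  When F1 is Riemannian the first
   block does not depend on the fibre coordinates, so the nonlinear connection
   of F never enters the coefficients
     F^i_jk = (Christoffel symbols of M1),
     F^i_(l alpha) = delta^i_l d_alpha f2 / f2,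
     F^alpha_jk = - f2 g^(alpha beta) d_beta f2 g_jk / f1^2,
   nor the derivatives of F^i_jk.  Summing over both blocks of indices, the
   curvature of F with all indices in M1 is that of M1 minus
   |grad f2|^2 / f1^2 (delta^i_l g_jk - delta^i_k g_jl), the Gauss equation of
   the slices M1 x {u}, and flatness concludes.  Derivatives are compared along
   lines, since all the functions involved are only controlled near a point. *)

(** * Directional derivatives along lines, and derivatives of the square of a function *)

Section Lines.
Variable R : realType.

(** Both [derive] and [derivable] are read off from this one image filter, so its equality transfers
    values and existence alike. The domains [V] and [V'] may differ: a partial derivative on a
    product is thus compared with one on a factor. *)
Lemma line_quotient_cvg (V V' W : normedModType R) (f : V -> W) (g : V' -> W)
    (x w : V) (x' w' : V') :
  (\forall t \near (0 : R), f (t *: w + x) = g (t *: w' + x')) ->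
  (fun h : R => h^-1 *: ((f \o shift x) (h *: w) - f x)) @ 0^' =
  (fun h : R => h^-1 *: ((g \o shift x') (h *: w') - g x')) @ 0^'.
Proof.
move=> fg; have := nbhs_singleton fg; rewrite !scale0r !add0r => fgx.
have fg' : \forall h \near 0^', h^-1 *: ((f \o shift x) (h *: w) - f x) =
    h^-1 *: ((g \o shift x') (h *: w') - g x').
  apply: cvg_within; apply: filterS fg => t ft.
  by rewrite /= ft fgx.
apply/seteqP; split; apply: near_eq_cvg => //.
by apply: filterS fg' => t ->.
Qed.

Lemma derive_line (V V' W : normedModType R) (f : V -> W) (g : V' -> W)
    (x w : V) (x' w' : V') :
  (\forall t \near (0 : R), f (t *: w + x) = g (t *: w' + x')) ->
  'D_w f x = 'D_w' g x'.
Proof. by rewrite /derive => /line_quotient_cvg ->. Qed.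

Lemma derivable_line (V V' W : normedModType R) (f : V -> W) (g : V' -> W)
    (x w : V) (x' w' : V') :
  (\forall t \near (0 : R), f (t *: w + x) = g (t *: w' + x')) ->
  derivable f x w -> derivable g x' w'.
Proof. by rewrite /derivable => /line_quotient_cvg ->. Qed.

Lemma derive_line_cst (V W : normedModType R) (f : V -> W) (x w : V) :
  (\forall t \near (0 : R), f (t *: w + x) = f x) -> 'D_w f x = 0.
Proof.
move=> fx.
by rewrite (derive_line (g := cst (f x)) (x' := x) (w' := w)) ?derive_cst.
Qed.

Lemma derive_affine (V : normedModType R) (f : V -> R^o) (c d : R) (x w : V) :
  derivable f x w -> 'D_w (fun y => c * f y + d : R^o) x = c * 'D_w f x.
Proof.
move=> df; have dcf : derivable (c \*: f) x w by exact: derivableZ.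
rewrite (deriveD dcf (derivable_cst (d : R^o) x w)) (deriveZ c df).
by rewrite derive_cst addr0.
Qed.

Lemma open_near_line (V : normedModType R) (U : set V) (x w : V) :
  open U -> U x -> \forall t \near (0 : R), U (t *: w + x).
Proof.
move=> oU Ux.
have : (fun t : R => t *: w + x) @ (0 : R) --> 0 *: w + x.
  by apply: cvgD; [apply: cvgZl; exact: cvg_id | exact: cvg_cst].
by apply; rewrite scale0r add0r; exact: open_nbhs_nbhs.
Qed.

Lemma open_neq0 (V : normedModType R) : open [set y : V | y != 0].
Proof.
rewrite (_ : [set y : V | y != 0] = ~` [set 0]); last first.
  by apply/seteqP; split=> y /= /eqP.
apply: closed_openC; apply: accessible_closed_set1.
by apply: hausdorff_accessible; exact: norm_hausdorff.
Qed.

Lemma near_neq0_line (V : normedModType R) (y w : V) : y != 0 ->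
  \forall t \near (0 : R), t *: w + y != 0.
Proof. by move=> y0; exact: (open_near_line w (@open_neq0 V) y0). Qed.

Lemma Ck_onW (V W : normedModType R) (k : nat) (U : set V) (f : V -> W) :
  Ck_on k.+1 U f -> Ck_on k U f.
Proof.
elim: k f => [|k IHk] f [df Df].
  by move=> x Ux; apply: differentiable_continuous; exact: df.
by split=> // v; apply: IHk; exact: Df.
Qed.

Lemma Ck_on_sqr_derivable (V : normedModType R) (U : set V) (G : V -> R^o)
    (z v : V) :
  Ck_on 1 U G -> U z -> derivable (fun z => G z ^+ 2 : R^o) z v.
Proof.
move=> [dG _] Uz; rewrite (_ : (fun _ => _) = G * G).
  by apply: derivableM; apply: diff_derivable; exact: dG.
by apply/funext => t; rewrite expr2.
Qed.

Lemma Ck_on_derive_sqr (V : normedModType R) (U : set V) (G : V -> R^o)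
    (z v : V) :
  Ck_on 1 U G -> U z ->
  'D_v (fun z => G z ^+ 2 : R^o) z = 2 * (G z * 'D_v G z).
Proof.
move=> [dG _] Uz; rewrite (_ : (fun _ => _) = G * G).
  rewrite deriveM; do ?by apply: diff_derivable; exact: dG.
  by rewrite mulrDl mul1r.
by apply/funext => t; rewrite expr2.
Qed.

(** Smoothness is assumed of F, whereas the fundamental tensor differentiates F^2. The product rule
    for the first derivative of the square holds only on [U], so it is carried over along a short
    line inside [U]. *)
Lemma Ck_on_derive_sqr_derivable (V : normedModType R) (U : set V)
    (G : V -> R^o) (z v w : V) : open U ->
  Ck_on 2 U G -> U z -> derivable ('D_v (fun z => G z ^+ 2 : R^o)) z w.
Proof.
move=> oU G2 Uz; have [dG DG] := G2.
apply: (derivable_line (f := 2 \*: (G * 'D_v G)) (x := z) (w := w)).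
  apply: filterS (open_near_line w oU Uz) => t Ut.
  by rewrite (@Ck_on_derive_sqr _ U) //; exact: Ck_onW.
apply: derivableZ; apply: derivableM; apply: diff_derivable; first exact: dG.
by have [+ _] := DG v; exact.
Qed.

Lemma Ck_on_derive2_sqr (V : normedModType R) (U : set V)
    (G : V -> R^o) (z v w : V) : open U ->
  Ck_on 2 U G -> U z -> 'D_w ('D_v (fun z => G z ^+ 2 : R^o)) z =
   2 * (G z * 'D_w ('D_v G) z + 'D_v G z * 'D_w G z).
Proof.
move=> oU G2 Uz; have [dG DG] := G2.
rewrite (derive_line (g := 2 \*: (G * 'D_v G)) (x' := z) (w' := w)).
  have dG1 : derivable G z w by apply: diff_derivable; exact: dG.
  have dG2 : derivable ('D_v G) z w.
    by apply: diff_derivable; have [+ _] := DG v; exact.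
  by rewrite deriveZ ?deriveM //; apply: derivableM.
apply: filterS (open_near_line w oU Uz) => t Ut.
by rewrite (@Ck_on_derive_sqr _ U) //; exact: Ck_onW.
Qed.

Lemma Ck_on_derive2_sqr_derivable (V : normedModType R) (U : set V)
    (G : V -> R^o) (z v w w' : V) : open U ->
  Ck_on 3 U G -> U z ->
  derivable ('D_w ('D_v (fun z => G z ^+ 2 : R^o))) z w'.
Proof.
move=> oU G3 Uz; have [dG DG] := G3.
apply: (derivable_line (f := 2 \*: (G * 'D_w ('D_v G) + 'D_v G * 'D_w G))
  (x := z) (w := w')).
  apply: filterS (open_near_line w' oU Uz) => t Ut.
  by rewrite (@Ck_on_derive2_sqr _ U) //; exact: Ck_onW.
have d1 u : derivable ('D_u G) z w'.
  by apply: diff_derivable; have [+ _] := DG u; exact.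
have d2 u u' : derivable ('D_u ('D_u' G)) z w'.
  apply: diff_derivable; have [_ DDG] := DG u'; have [+ _] := DDG u; exact.
by apply: derivableZ; apply: derivableD; apply: derivableM => //;
  apply: diff_derivable; exact: dG.
Qed.

End Lines.

(** * Regularity of F^2 in induced coordinates on the slit tangent bundle *)

Section SmoothFields.
Variables (R : realType) (n : nat) (U : set 'rV[R]_n).
Variable F : 'rV[R]_n -> 'rV[R]_n -> R.
Hypothesis openU : open U.

Definition slit : set ('rV[R]_n * 'rV[R]_n) :=
  [set z | U z.1 /\ z.2 != 0].

Hypothesis smoothF : smooth_on (W := R^o) slit (fun z => F z.1 z.2).

Lemma open_slit : open slit.
Proof.
apply: openI.
  by apply: open_comp => // z _; exact: cvg_fst.
apply: (@open_comp _ _ snd [set y : 'rV[R]_n | y != 0]) => [z _|].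
  exact: cvg_snd.
exact: open_neq0.
Qed.

(** The C^k hypotheses concern functions of the pair (position, fibre). Stated as an equality of
    functions, this can be rewritten repeatedly and so handles iterated fibre derivatives. *)
Lemma dfib_pair (h : 'rV[R]_n -> 'rV[R]_n -> R) (a : 'I_n) :
  (fun z => dfib a h z.1 z.2) =
  'D_((0, delta_mx 0 a) : 'rV[R]_n * 'rV[R]_n)
     (fun z : 'rV[R]_n * 'rV[R]_n => h z.1 z.2 : R^o).
Proof.
apply/funext => -[x y]; apply: derive_line.
by near=> t; rewrite /= scaler0 add0r.
Unshelve. all: by end_near. Qed.

Let derivable_fib (h : 'rV[R]_n -> 'rV[R]_n -> R) (x y w : 'rV[R]_n) :
  derivable (fun z : 'rV[R]_n * 'rV[R]_n => h z.1 z.2 : R^o) (x, y) (0, w) ->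
  derivable (h x : _ -> R^o) y w.
Proof.
apply: derivable_line.
by near=> t; rewrite /= scaler0 add0r.
Unshelve. all: by end_near. Qed.

Let derivable_pos (h : 'rV[R]_n -> 'rV[R]_n -> R) (x y w : 'rV[R]_n) :
  derivable (fun z : 'rV[R]_n * 'rV[R]_n => h z.1 z.2 : R^o) (x, y) (w, 0) ->
  derivable (h ^~ y : _ -> R^o) x w.
Proof.
apply: derivable_line.
by near=> t; rewrite /= scaler0 add0r.
Unshelve. all: by end_near. Qed.

Lemma sqr_fld_derivable (x y w : 'rV[R]_n) : U x -> y != 0 ->
  derivable (sqr_fld F x : _ -> R^o) y w.
Proof.
move=> Ux y0; apply: derivable_fib.
by apply: Ck_on_sqr_derivable (smoothF 1) _; split.
Qed.

Lemma dfib_sqr_fld_derivable (a : 'I_n) (x y w : 'rV[R]_n) : U x -> y != 0 ->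
  derivable (dfib a (sqr_fld F) x : _ -> R^o) y w.
Proof.
move=> Ux y0; apply: derivable_fib; rewrite dfib_pair.
by apply: Ck_on_derive_sqr_derivable open_slit (smoothF 2) _; split.
Qed.

(** Two fibre derivatives and one position derivative of F^2 meet here, hence the use of C^3. *)
Lemma fund_derivable (a b : 'I_n) (x y w : 'rV[R]_n) : U x -> y != 0 ->
  derivable (fund F a b ^~ y : _ -> R^o) x w.
Proof.
move=> Ux y0; apply: (@derivable_pos (fund F a b)).
apply: (@derivableZ _ _ _ (fun z => dfib a (dfib b (sqr_fld F)) z.1 z.2)).
rewrite !dfib_pair.
by apply: Ck_on_derive2_sqr_derivable open_slit (smoothF 3) _; split.
Qed.

End SmoothFields.

(** * The horizontal derivative of functions that do not vary along the fibre *)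

Section DeltaD.
Variables (R : realType) (n : nat).
Variables F h : 'rV[R]_n -> 'rV[R]_n -> R.

(** The nonlinear connection enters only as a coefficient of fibre derivatives. Through this lemma
    it drops out everywhere below, and no spray coefficient is ever computed. *)
Lemma delta_d_dpos (d : 'I_n) (x y : 'rV[R]_n) :
  (forall b, dfib b h x y = 0) -> delta_d F d h x y = dpos d h x y.
Proof.
by move=> h0; rewrite /delta_d big1 ?subr0 // => b _; rewrite h0 mulr0.
Qed.

Lemma dpos_cst (d : 'I_n) (x y : 'rV[R]_n) :
  (forall w, \forall t \near (0 : R), h (t *: w + x) y = h x y) ->
  dpos d h x y = 0.
Proof. by move=> h0; apply: derive_line_cst; exact: h0. Qed.

Lemma dfib_cst (d : 'I_n) (x y : 'rV[R]_n) :
  (\forall t \near (0 : R), h x (t *: delta_mx 0 d + y) = h x y) ->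
  dfib d h x y = 0.
Proof. by move=> h0; apply: derive_line_cst; exact: h0. Qed.

End DeltaD.

(** * Fibre independence of the metric, its inverse and its connection in the Riemannian case *)

Section RiemannianField.
Variables (R : realType) (n : nat) (U : set 'rV[R]_n).
Variable F : 'rV[R]_n -> 'rV[R]_n -> R.
Hypothesis openU : open U.
Hypothesis riemF : forall x y y' : 'rV[R]_n, U x -> y != 0 -> y' != 0 ->
  fund_mx F x y = fund_mx F x y'.

Lemma fund_fib (a b : 'I_n) (x y y' : 'rV[R]_n) : U x -> y != 0 -> y' != 0 ->
  fund F a b x y = fund F a b x y'.
Proof.
move=> Ux y0 y0'; have fundE z : fund F a b x z = fund_mx F x z a b.
  by rewrite mxE.
by rewrite !fundE (riemF Ux y0 y0').
Qed.

Lemma fund_inv_fib (a b : 'I_n) (x y y' : 'rV[R]_n) :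
  U x -> y != 0 -> y' != 0 -> fund_inv F a b x y = fund_inv F a b x y'.
Proof. by move=> Ux y0 y0'; rewrite /fund_inv (riemF Ux y0 y0'). Qed.

Lemma delta_d_fund (d a b : 'I_n) (x y : 'rV[R]_n) : U x -> y != 0 ->
  delta_d F d (fund F a b) x y = dpos d (fund F a b) x y.
Proof.
move=> Ux y0; apply: delta_d_dpos => c; apply: dfib_cst.
by apply: filterS (near_neq0_line (delta_mx 0 c) y0) => t yt; exact: fund_fib.
Qed.

Lemma dpos_fund_fib (d a b : 'I_n) (x y y' : 'rV[R]_n) :
  U x -> y != 0 -> y' != 0 ->
  dpos d (fund F a b) x y = dpos d (fund F a b) x y'.
Proof.
move=> Ux y0 y0'; apply: derive_line.
apply: filterS (open_near_line (delta_mx 0 d) openU Ux) => t Ut.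
exact: fund_fib.
Qed.

(** Every horizontal derivative in the formula reduces to a position derivative of the metric, which
    leaves the classical Christoffel symbols. *)
Lemma lin_conn_fib (c a b : 'I_n) (x y y' : 'rV[R]_n) :
  U x -> y != 0 -> y' != 0 -> lin_conn F c a b x y = lin_conn F c a b x y'.
Proof.
move=> Ux y0 y0'; rewrite /lin_conn.
apply: (congr1 ( *%R 2^-1)); apply: eq_bigr => e _.
have dE a' b' c' : delta_d F a' (fund F b' c') x y =
    delta_d F a' (fund F b' c') x y'.
  rewrite (delta_d_fund _ _ _ Ux y0) (delta_d_fund _ _ _ Ux y0').
  exact: dpos_fund_fib.
by rewrite !dE (fund_inv_fib _ _ Ux y0 y0').
Qed.

Lemma delta_d_lin_conn (d c a b : 'I_n) (x y : 'rV[R]_n) : U x -> y != 0 ->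
  delta_d F d (lin_conn F c a b) x y = dpos d (lin_conn F c a b) x y.
Proof.
move=> Ux y0; apply: delta_d_dpos => e; apply: dfib_cst.
apply: filterS (near_neq0_line (delta_mx 0 e) y0) => t yt.
exact: lin_conn_fib.
Qed.

End RiemannianField.

(** * Splitting indices into two blocks, and inverses of block diagonal matrices *)

Section Splitting.
Variable R : realType.

(* A partition of the index set; it is symmetric in the two blocks, which is
   what makes the two halves of the theorem instances of one computation. *)
Record index_split (n1 n2 n : nat) (s1 : 'I_n1 -> 'I_n) (s2 : 'I_n2 -> 'I_n) :=
  IndexSplit {
  split_inj1 : injective s1;
  split_inj2 : injective s2;
  split_disjoint : forall i j, s1 i != s2 j;
  split_cover : forall a, (exists i, a = s1 i) \/ (exists j, a = s2 j);
  split_sum : forall h : 'I_n -> R,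
    \sum_a h a = \sum_i h (s1 i) + \sum_j h (s2 j)
}.

Lemma index_splitC (n1 n2 n : nat) (s1 : 'I_n1 -> 'I_n) (s2 : 'I_n2 -> 'I_n) :
  index_split s1 s2 -> index_split s2 s1.
Proof.
case=> i1 i2 d c s; split=> //.
- by move=> i j; rewrite eq_sym.
- by move=> a; case: (c a); [right | left].
- by move=> h; rewrite s addrC.
Qed.

Lemma index_split_ord (n1 n2 : nat) :
  index_split (@lshift n1 n2) (@rshift n1 n2).
Proof.
split.
- exact: lshift_inj.
- exact: rshift_inj.
- by move=> i j; rewrite eq_lrshift.
- by move=> a; case: (split_ordP a) => j ->; [left | right]; exists j.
- by move=> h; rewrite big_split_ord.
Qed.

(** This replaces [lsubmx] and [rsubmx], which would fix the order of the two factors. *)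
Definition subrow (m n : nat) (s : 'I_m -> 'I_n) (x : 'rV[R]_n) : 'rV[R]_m :=
  colsub s x.

Lemma subrow_line (m n : nat) (s : 'I_m -> 'I_n) (t : R) (w x : 'rV[R]_n) :
  subrow s (t *: w + x) = t *: subrow s w + subrow s x.
Proof. by apply/rowP => i; rewrite !mxE. Qed.

Lemma subrow_delta (m n : nat) (s : 'I_m -> 'I_n) (i : 'I_m) :
  injective s -> subrow s (delta_mx 0 (s i)) = delta_mx 0 i.
Proof. by move=> si; apply/rowP => j; rewrite !mxE (inj_eq si). Qed.

Lemma subrow_delta0 (m n : nat) (s : 'I_m -> 'I_n) (a : 'I_n) :
  (forall i, s i != a) -> subrow s (delta_mx 0 a) = 0.
Proof.
by move=> sa; apply/rowP => j; rewrite !mxE (negbTE (sa j)) andbF.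
Qed.

Section BlockInverse.
Variables (n1 n2 n : nat) (s1 : 'I_n1 -> 'I_n) (s2 : 'I_n2 -> 'I_n).
Hypothesis s12 : index_split s1 s2.
Variables (M : 'M[R]_n) (A1 : 'M[R]_n1) (A2 : 'M[R]_n2) (c1 c2 : R).
Hypotheses (c1_neq0 : c1 != 0) (c2_neq0 : c2 != 0).
Hypotheses (A1_unit : A1 \in unitmx) (A2_unit : A2 \in unitmx).
Hypothesis M11 : forall i k, M (s1 i) (s1 k) = c1 * A1 i k.
Hypothesis M12 : forall i j, M (s1 i) (s2 j) = 0.
Hypothesis M21 : forall j i, M (s2 j) (s1 i) = 0.
Hypothesis M22 : forall j l, M (s2 j) (s2 l) = c2 * A2 j l.

(** The vanishing block [M21] decouples the columns. All facts about [invmx M] below follow by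
    choosing [X]. *)
Let mul_block1 m (X : 'M[R]_(m, n)) :
  colsub s1 (X *m M) = c1 *: (colsub s1 X *m A1).
Proof.
apply/matrixP => i k; rewrite !mxE (split_sum s12) [X in _ + X]big1; last first.
  by move=> j _; rewrite M21 mulr0.
rewrite addr0 mulr_sumr; apply: eq_bigr => j _.
by rewrite M11 !mxE mulrCA.
Qed.

Let mul_block2 m (X : 'M[R]_(m, n)) :
  colsub s2 (X *m M) = c2 *: (colsub s2 X *m A2).
Proof.
apply/matrixP => i k; rewrite !mxE (split_sum s12) [X in X + _]big1; last first.
  by move=> j _; rewrite M12 mulr0.
rewrite add0r mulr_sumr; apply: eq_bigr => j _.
by rewrite M22 !mxE mulrCA.
Qed.

Let colsub_eq0 m (X : 'M[R]_(m, n)) :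
  colsub s1 X = 0 -> colsub s2 X = 0 -> X = 0.
Proof.
move=> /matrixP X1 /matrixP X2; apply/matrixP => i a; rewrite mxE.
case: (split_cover s12 a) => -[j ->].
  by have := X1 i j; rewrite !mxE.
by have := X2 i j; rewrite !mxE.
Qed.

Let scale_unit_eq0 m k (c : R) (A : 'M[R]_k) (B : 'M[R]_(m, k)) :
  c != 0 -> A \in unitmx -> c *: (B *m A) = 0 -> B = 0.
Proof.
move=> c0 uA /eqP; rewrite scaler_eq0 (negbTE c0) /= => /eqP BA.
by rewrite -[B](mulmxK uA) BA mul0mx.
Qed.

Let M_unit : M \in unitmx.
Proof.
(* If [M] kills [v], then the invertible [A1] and [A2] kill its two blocks. *)
rewrite -row_free_unit; apply/inj_row_free => v vM.
apply: colsub_eq0.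
  apply: scale_unit_eq0 c1_neq0 A1_unit _.
  by rewrite -mul_block1 vM; apply/matrixP => i j; rewrite !mxE.
apply: scale_unit_eq0 c2_neq0 A2_unit _.
by rewrite -mul_block2 vM; apply/matrixP => i j; rewrite !mxE.
Qed.

(** Take for [X] the [s1] rows of the inverse: [X *m M] consists of rows of the identity, so its
    [s1] columns form [1%:M]. In [invmx_block12] its [s2] columns vanish instead. *)
Lemma invmx_block11 i k : invmx M (s1 i) (s1 k) = c1^-1 * invmx A1 i k.
Proof.
have := mul_block1 (rowsub s1 (invmx M)).
rewrite mul_rowsub_mx mulVmx // => e.
suff -> : invmx A1 = c1 *: colsub s1 (rowsub s1 (invmx M)).
  by rewrite !mxE mulKf.
rewrite -[RHS](mulmxK A1_unit) -scalemxAl -e.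
rewrite (_ : colsub _ _ = 1%:M) ?mul1mx //.
by apply/matrixP => a b; rewrite !mxE (inj_eq (split_inj1 s12)).
Qed.

Lemma invmx_block12 i j : invmx M (s1 i) (s2 j) = 0.
Proof.
suff /matrixP/(_ i j) : colsub s2 (rowsub s1 (invmx M)) = 0 by rewrite !mxE.
apply: scale_unit_eq0 c2_neq0 A2_unit _; rewrite -mul_block2.
rewrite mul_rowsub_mx mulVmx //; apply/matrixP => a b.
by rewrite !mxE (negbTE (split_disjoint s12 _ _)).
Qed.

End BlockInverse.
End Splitting.

Section SplitLines.
Variables (R : realType) (n1 n2 n : nat).
Variables (s1 : 'I_n1 -> 'I_n) (s2 : 'I_n2 -> 'I_n).
Hypothesis s12 : index_split R s1 s2.

Lemma subrow_line_in (t : R) (i : 'I_n1) (x : 'rV[R]_n) :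
  subrow s1 (t *: delta_mx 0 (s1 i) + x) = t *: delta_mx 0 i + subrow s1 x.
Proof. by rewrite subrow_line (subrow_delta _ _ (split_inj1 s12)). Qed.

Lemma subrow_line_out (t : R) (i : 'I_n1) (x : 'rV[R]_n) :
  subrow s2 (t *: delta_mx 0 (s1 i) + x) = subrow s2 x.
Proof.
rewrite subrow_line subrow_delta0 ?scaler0 ?add0r // => j.
by rewrite eq_sym (split_disjoint s12).
Qed.

End SplitLines.

(** * The fundamental tensor of the warped metric and its position derivatives *)

Section WarpedFund.
Variables (R : realType) (n1 n2 n : nat).
Variables (s1 : 'I_n1 -> 'I_n) (s2 : 'I_n2 -> 'I_n).
Hypothesis s12 : index_split R s1 s2.
Variables (F : 'rV[R]_n -> 'rV[R]_n -> R).
Variables (F1 : 'rV[R]_n1 -> 'rV[R]_n1 -> R).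
Variables (F2 : 'rV[R]_n2 -> 'rV[R]_n2 -> R).
Variables (h1 : 'rV[R]_n1 -> R) (h2 : 'rV[R]_n2 -> R).
Hypothesis sqrE : forall x y, sqr_fld F x y =
  h2 (subrow s2 x) ^+ 2 * sqr_fld F1 (subrow s1 x) (subrow s1 y) +
  h1 (subrow s1 x) ^+ 2 * sqr_fld F2 (subrow s2 x) (subrow s2 y).
Variable U1 : set 'rV[R]_n1.
Hypothesis openU1 : open U1.
Hypothesis smoothF1 :
  smooth_on (W := R^o) (slit U1) (fun z => F1 z.1 z.2).

(** Along a fibre line in an [s1] direction only F1^2 varies, so F^2 is an affine function of it. *)
Lemma warped_dfib_sqr (i : 'I_n1) (x y : 'rV[R]_n) :
  U1 (subrow s1 x) -> subrow s1 y != 0 ->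
  dfib (s1 i) (sqr_fld F) x y =
  h2 (subrow s2 x) ^+ 2 * dfib i (sqr_fld F1) (subrow s1 x) (subrow s1 y).
Proof.
move=> Ux y0; pose c := h2 (subrow s2 x) ^+ 2.
pose d : R^o := h1 (subrow s1 x) ^+ 2 * sqr_fld F2 (subrow s2 x) (subrow s2 y).
pose f : 'rV[R]_n1 -> R^o := sqr_fld F1 (subrow s1 x).
have df : derivable f (subrow s1 y) (delta_mx 0 i).
  exact: (sqr_fld_derivable smoothF1 Ux y0).
rewrite -(derive_affine c d df); apply: derive_line; apply: filterE => t.
by rewrite sqrE (subrow_line_in s12) (subrow_line_out s12).
Qed.

Lemma warped_fund11 (i k : 'I_n1) (x y : 'rV[R]_n) :
  U1 (subrow s1 x) -> subrow s1 y != 0 ->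
  fund F (s1 i) (s1 k) x y =
  h2 (subrow s2 x) ^+ 2 * fund F1 i k (subrow s1 x) (subrow s1 y).
Proof.
move=> Ux y0; pose c := h2 (subrow s2 x) ^+ 2.
pose f : 'rV[R]_n1 -> R^o := dfib k (sqr_fld F1) (subrow s1 x).
have df : derivable f (subrow s1 y) (delta_mx 0 i).
  exact: (dfib_sqr_fld_derivable openU1 smoothF1 Ux y0).
have E : dfib (s1 i) (dfib (s1 k) (sqr_fld F)) x y =
    'D_(delta_mx 0 i) (c \*: f) (subrow s1 y).
  apply: derive_line.
  apply: filterS (near_neq0_line (delta_mx 0 i) y0) => t yt.
  by rewrite warped_dfib_sqr ?(subrow_line_in s12).
by rewrite /fund E deriveZ // mulrCA.
Qed.

(** The inner derivative, in an [s1] direction, no longer involves the [s2] part of the fibre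
    vector, so the outer one vanishes. *)
Lemma warped_fund21 (j : 'I_n2) (k : 'I_n1) (x y : 'rV[R]_n) :
  U1 (subrow s1 x) -> subrow s1 y != 0 ->
  fund F (s2 j) (s1 k) x y = 0.
Proof.
move=> Ux y0; rewrite /fund [X in _ * X]dfib_cst ?mulr0 //.
apply: filterE => t.
by rewrite !warped_dfib_sqr ?(subrow_line_out (index_splitC s12)).
Qed.

Lemma warped_dpos_fund11 (d e k : 'I_n1) (x y : 'rV[R]_n) :
  U1 (subrow s1 x) -> subrow s1 y != 0 ->
  dpos (s1 d) (fund F (s1 e) (s1 k)) x y =
  h2 (subrow s2 x) ^+ 2 * dpos d (fund F1 e k) (subrow s1 x) (subrow s1 y).
Proof.
move=> Ux y0; pose c := h2 (subrow s2 x) ^+ 2.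
pose f : 'rV[R]_n1 -> R^o := fund F1 e k ^~ (subrow s1 y).
have df : derivable f (subrow s1 x) (delta_mx 0 d).
  exact: (fund_derivable openU1 smoothF1 Ux y0).
transitivity ('D_(delta_mx 0 d) (c \*: f) (subrow s1 x)); last first.
  by rewrite deriveZ.
apply: derive_line.
apply: filterS (open_near_line (delta_mx 0 d) openU1 Ux) => t Ut.
by rewrite warped_fund11 ?(subrow_line_in s12) ?(subrow_line_out s12).
Qed.

Lemma warped_dpos2_fund11 (d : 'I_n2) (e k : 'I_n1) (x y : 'rV[R]_n) :
  U1 (subrow s1 x) -> subrow s1 y != 0 ->
  derivable (h2 : _ -> R^o) (subrow s2 x) (delta_mx 0 d) ->
  dpos (s2 d) (fund F (s1 e) (s1 k)) x y =
  2 * h2 (subrow s2 x) * 'D_(delta_mx 0 d) (h2 : _ -> R^o) (subrow s2 x) *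
  fund F1 e k (subrow s1 x) (subrow s1 y).
Proof.
move=> Ux y0 dh; pose c := fund F1 e k (subrow s1 x) (subrow s1 y).
pose f : 'rV[R]_n2 -> R^o := h2.
transitivity ('D_(delta_mx 0 d) (c \*: (f * f)) (subrow s2 x)).
  apply: derive_line; apply: filterE => t.
  rewrite warped_fund11 ?(subrow_line_out (index_splitC s12)) //.
  by rewrite (subrow_line_in (index_splitC s12)) mulrC.
rewrite deriveZ; last exact: derivableM.
rewrite deriveM // -/c /f /GRing.scale /=; ring.
Qed.

End WarpedFund.

(** * The domain of the warped metric and the inverse of its fundamental tensor *)

Section WarpedInverse.
Variables (R : realType) (n1 n2 n : nat).
Variables (s1 : 'I_n1 -> 'I_n) (s2 : 'I_n2 -> 'I_n).
Hypothesis s12 : index_split R s1 s2.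
Variables (F : 'rV[R]_n -> 'rV[R]_n -> R).
Variables (F1 : 'rV[R]_n1 -> 'rV[R]_n1 -> R).
Variables (F2 : 'rV[R]_n2 -> 'rV[R]_n2 -> R).
Variables (h1 : 'rV[R]_n1 -> R) (h2 : 'rV[R]_n2 -> R).
Hypothesis sqrE : forall x y, sqr_fld F x y =
  h2 (subrow s2 x) ^+ 2 * sqr_fld F1 (subrow s1 x) (subrow s1 y) +
  h1 (subrow s1 x) ^+ 2 * sqr_fld F2 (subrow s2 x) (subrow s2 y).
Variables (U1 : set 'rV[R]_n1) (U2 : set 'rV[R]_n2).
Hypotheses (openU1 : open U1) (openU2 : open U2).
Hypothesis smoothF1 :
  smooth_on (W := R^o) (slit U1) (fun z => F1 z.1 z.2).
Hypothesis smoothF2 :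
  smooth_on (W := R^o) (slit U2) (fun z => F2 z.1 z.2).

(** Both fibre components must be nonzero, as on the product of the slit bundles: F1^2 and F2^2 need
    not be twice differentiable on the zero sections. *)
Definition warped_dom (x y : 'rV[R]_n) : Prop :=
  [/\ U1 (subrow s1 x), U2 (subrow s2 x),
      subrow s1 y != 0 & subrow s2 y != 0].

Lemma warped_dom_pos (x y w : 'rV[R]_n) : warped_dom x y ->
  \forall t \near (0 : R), warped_dom (t *: w + x) y.
Proof.
move=> [Ux1 Ux2 y1 y2].
have near1 := open_near_line (subrow s1 w) openU1 Ux1.
have near2 := open_near_line (subrow s2 w) openU2 Ux2.
near=> t; split=> //; rewrite subrow_line; near: t; assumption.
Unshelve. all: by end_near. Qed.

Lemma warped_dom_fib (x y w : 'rV[R]_n) : warped_dom x y ->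
  \forall t \near (0 : R), warped_dom x (t *: w + y).
Proof.
move=> [Ux1 Ux2 y1 y2].
have near1 := near_neq0_line (subrow s1 w) y1.
have near2 := near_neq0_line (subrow s2 w) y2.
near=> t; split=> //; rewrite subrow_line; near: t; assumption.
Unshelve. all: by end_near. Qed.

Lemma warped_sqrC x y : sqr_fld F x y =
  h1 (subrow s1 x) ^+ 2 * sqr_fld F2 (subrow s2 x) (subrow s2 y) +
  h2 (subrow s2 x) ^+ 2 * sqr_fld F1 (subrow s1 x) (subrow s1 y).
Proof. by rewrite sqrE addrC. Qed.

(** Each order of the indices comes from one naming of the blocks, so symmetry of second derivatives
    is not invoked. *)
Lemma warped_fund_off (x y : 'rV[R]_n) (i : 'I_n1) (j : 'I_n2) :
  warped_dom x y ->
  fund F (s1 i) (s2 j) x y = 0 /\ fund F (s2 j) (s1 i) x y = 0.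
Proof.
move=> [Ux1 Ux2 y1 y2]; split.
  exact: (warped_fund21 (index_splitC s12) warped_sqrC smoothF2).
exact: (warped_fund21 s12 sqrE smoothF1).
Qed.

(** The domain contains a short piece of every position line and every fibre line through its
    points, so [h] vanishes along all of them. *)
Lemma delta_d_eq0 (G h : 'rV[R]_n -> 'rV[R]_n -> R) (d : 'I_n)
    (x y : 'rV[R]_n) :
  (forall x y, warped_dom x y -> h x y = 0) ->
  warped_dom x y -> delta_d G d h x y = 0.
Proof.
move=> h0 xy; have hxy := h0 _ _ xy.
rewrite delta_d_dpos => [|b].
  apply: dpos_cst => w; apply: filterS (warped_dom_pos w xy) => t xyt.
  by rewrite hxy; exact: h0.
apply: dfib_cst; apply: filterS (warped_dom_fib (delta_mx 0 b) xy) => t xyt.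
by rewrite hxy; exact: h0.
Qed.

Hypothesis unitF1 : forall x y : 'rV[R]_n1, U1 x -> y != 0 ->
  fund_mx F1 x y \in unitmx.
Hypothesis unitF2 : forall x y : 'rV[R]_n2, U2 x -> y != 0 ->
  fund_mx F2 x y \in unitmx.
Hypothesis h1_neq0 : forall x, U1 x -> h1 x != 0.
Hypothesis h2_neq0 : forall x, U2 x -> h2 x != 0.

(** Only the [s1] rows are treated; the [s2] rows follow by exchanging the blocks. *)
Lemma warped_fund_inv (x y : 'rV[R]_n) : warped_dom x y ->
  (forall i k, fund_inv F (s1 i) (s1 k) x y =
     (h2 (subrow s2 x) ^+ 2)^-1 *
     fund_inv F1 i k (subrow s1 x) (subrow s1 y)) /\
  (forall i j, fund_inv F (s1 i) (s2 j) x y = 0).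
Proof.
move=> xy; have [Ux1 Ux2 y1 y2] := xy.
have c1 : h2 (subrow s2 x) ^+ 2 != 0 by rewrite sqrf_eq0 h2_neq0.
have c2 : h1 (subrow s1 x) ^+ 2 != 0 by rewrite sqrf_eq0 h1_neq0.
have u1 := unitF1 Ux1 y1; have u2 := unitF2 Ux2 y2.
have mxe m (G : 'rV[R]_m -> 'rV[R]_m -> R) a b z z' :
  fund_mx G z z' a b = fund G a b z z' by rewrite mxE.
have M11 i k : fund_mx F x y (s1 i) (s1 k) =
    h2 (subrow s2 x) ^+ 2 * fund_mx F1 (subrow s1 x) (subrow s1 y) i k.
  by rewrite !mxe; exact: (warped_fund11 s12 sqrE openU1 smoothF1).
have M22 j l : fund_mx F x y (s2 j) (s2 l) =
    h1 (subrow s1 x) ^+ 2 * fund_mx F2 (subrow s2 x) (subrow s2 y) j l.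
  rewrite !mxe.
  exact: (warped_fund11 (index_splitC s12) warped_sqrC openU2 smoothF2).
have M12 i j : fund_mx F x y (s1 i) (s2 j) = 0.
  by rewrite mxe; have [] := warped_fund_off i j xy.
have M21 j i : fund_mx F x y (s2 j) (s1 i) = 0.
  by rewrite mxe; have [] := warped_fund_off i j xy.
split=> i k.
  exact: (invmx_block11 s12 c1 c2 u1 u2 M11 M12 M21 M22).
exact: (invmx_block12 s12 c1 c2 u1 u2 M11 M12 M21 M22).
Qed.

End WarpedInverse.

(** * Connection coefficients and curvature in the directions of a Riemannian first factor *)

Section WarpedCurvature.
Variables (R : realType) (n1 n2 n : nat).
Variables (s1 : 'I_n1 -> 'I_n) (s2 : 'I_n2 -> 'I_n).
Hypothesis s12 : index_split R s1 s2.
Variables (F : 'rV[R]_n -> 'rV[R]_n -> R).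
Variables (F1 : 'rV[R]_n1 -> 'rV[R]_n1 -> R).
Variables (F2 : 'rV[R]_n2 -> 'rV[R]_n2 -> R).
Variables (h1 : 'rV[R]_n1 -> R) (h2 : 'rV[R]_n2 -> R).
Hypothesis sqrE : forall x y, sqr_fld F x y =
  h2 (subrow s2 x) ^+ 2 * sqr_fld F1 (subrow s1 x) (subrow s1 y) +
  h1 (subrow s1 x) ^+ 2 * sqr_fld F2 (subrow s2 x) (subrow s2 y).
Variables (U1 : set 'rV[R]_n1) (U2 : set 'rV[R]_n2).
Hypotheses (openU1 : open U1) (openU2 : open U2).
Hypothesis smoothF1 :
  smooth_on (W := R^o) (slit U1) (fun z => F1 z.1 z.2).
Hypothesis smoothF2 :
  smooth_on (W := R^o) (slit U2) (fun z => F2 z.1 z.2).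
Hypothesis unitF1 : forall x y : 'rV[R]_n1, U1 x -> y != 0 ->
  fund_mx F1 x y \in unitmx.
Hypothesis unitF2 : forall x y : 'rV[R]_n2, U2 x -> y != 0 ->
  fund_mx F2 x y \in unitmx.
Hypothesis h1_neq0 : forall x, U1 x -> h1 x != 0.
Hypothesis h2_neq0 : forall x, U2 x -> h2 x != 0.
Hypothesis h2_derivable : forall x w, U2 x -> derivable (h2 : _ -> R^o) x w.
Hypothesis riemF1 : forall x y y' : 'rV[R]_n1, U1 x -> y != 0 -> y' != 0 ->
  fund_mx F1 x y = fund_mx F1 x y'.

Local Notation dom := (warped_dom s1 s2 U1 U2).
Local Notation dh2 a z := ('D_(delta_mx 0 a) (h2 : _ -> R^o) z).

Let s21 := index_splitC s12.
Let sqrE' := warped_sqrC sqrE.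

Let fund11E := warped_fund11 s12 sqrE openU1 smoothF1.

(** The warping factor depends on position alone, so the whole first block inherits fibre
    independence from F1. The direction [d] may lie in either block. *)
Lemma warped_delta_d_fund11 (d : 'I_n) (e k : 'I_n1) (x y : 'rV[R]_n) :
  dom x y ->
  delta_d F d (fund F (s1 e) (s1 k)) x y = dpos d (fund F (s1 e) (s1 k)) x y.
Proof.
move=> xy; have [Ux1 _ y1 _] := xy.
apply: delta_d_dpos => b; apply: dfib_cst.
apply: filterS (warped_dom_fib (delta_mx 0 b) xy) => t [_ _ yt1 _].
by rewrite (fund11E _ _ Ux1 yt1) (fund11E _ _ Ux1 y1)
  (fund_fib riemF1 _ _ Ux1 yt1 y1).
Qed.

Let delta_d_fund11 (d e k : 'I_n1) (x y : 'rV[R]_n) : dom x y ->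
  delta_d F (s1 d) (fund F (s1 e) (s1 k)) x y =
  h2 (subrow s2 x) ^+ 2 *
    delta_d F1 d (fund F1 e k) (subrow s1 x) (subrow s1 y).
Proof.
move=> xy; have [Ux1 _ y1 _] := xy.
rewrite (warped_delta_d_fund11 _ _ _ xy).
rewrite (delta_d_fund riemF1 _ _ _ Ux1 y1).
exact: (warped_dpos_fund11 s12 sqrE openU1 smoothF1).
Qed.

Let delta_d2_fund11 (d : 'I_n2) (e k : 'I_n1) (x y : 'rV[R]_n) : dom x y ->
  delta_d F (s2 d) (fund F (s1 e) (s1 k)) x y =
  2 * h2 (subrow s2 x) * dh2 d (subrow s2 x) *
  fund F1 e k (subrow s1 x) (subrow s1 y).
Proof.
move=> xy; have [Ux1 Ux2 y1 _] := xy.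
rewrite (warped_delta_d_fund11 _ _ _ xy).
apply: (warped_dpos2_fund11 s12 sqrE openU1 smoothF1) => //.
exact: h2_derivable.
Qed.

Let delta_d_fund12 (d : 'I_n) (i : 'I_n1) (j : 'I_n2) (x y : 'rV[R]_n) :
  dom x y -> delta_d F d (fund F (s1 i) (s2 j)) x y = 0.
Proof.
apply: (delta_d_eq0 openU1 openU2) => x' y' xy'.
by have [] := warped_fund_off s12 sqrE smoothF1 smoothF2 i j xy'.
Qed.

Let delta_d_fund21 (d : 'I_n) (i : 'I_n1) (j : 'I_n2) (x y : 'rV[R]_n) :
  dom x y -> delta_d F d (fund F (s2 j) (s1 i)) x y = 0.
Proof.
apply: (delta_d_eq0 openU1 openU2) => x' y' xy'.
by have [] := warped_fund_off s12 sqrE smoothF1 smoothF2 i j xy'.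
Qed.

Let fund_inv1 (x y : 'rV[R]_n) (xy : dom x y) := warped_fund_inv s12 sqrE
  openU1 openU2 smoothF1 smoothF2 unitF1 unitF2 h1_neq0 h2_neq0 xy.

Let fund_inv2 (x y : 'rV[R]_n) (xy : dom x y) :
  (forall i k, fund_inv F (s2 i) (s2 k) x y =
     (h1 (subrow s1 x) ^+ 2)^-1 *
     fund_inv F2 i k (subrow s2 x) (subrow s2 y)) /\
  (forall i j, fund_inv F (s2 i) (s1 j) x y = 0).
Proof.
apply: (warped_fund_inv s21 sqrE' openU2 openU1 smoothF2 smoothF1
  unitF2 unitF1 h2_neq0 h1_neq0).
by case: xy.
Qed.

Let lin_conn_row1 (i : 'I_n1) (a b : 'I_n) (x y : 'rV[R]_n) : dom x y ->
  lin_conn F (s1 i) a b x y = 2^-1 * \sum_e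
   (h2 (subrow s2 x) ^+ 2)^-1 * fund_inv F1 i e (subrow s1 x) (subrow s1 y) *
    (delta_d F b (fund F (s1 e) a) x y + delta_d F a (fund F (s1 e) b) x y
     - delta_d F (s1 e) (fund F a b) x y).
Proof.
move=> xy; have [inv11 inv12] := fund_inv1 xy.
rewrite /lin_conn (split_sum s12) [X in _ * (_ + X)]big1 ?addr0.
  by apply: (congr1 ( *%R 2^-1)); apply: eq_bigr => e _; rewrite inv11.
by move=> e _; rewrite inv12 mul0r.
Qed.

Let lin_conn_row2 (i : 'I_n2) (a b : 'I_n) (x y : 'rV[R]_n) : dom x y ->
  lin_conn F (s2 i) a b x y = 2^-1 * \sum_e
   (h1 (subrow s1 x) ^+ 2)^-1 * fund_inv F2 i e (subrow s2 x) (subrow s2 y) *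
    (delta_d F b (fund F (s2 e) a) x y + delta_d F a (fund F (s2 e) b) x y
     - delta_d F (s2 e) (fund F a b) x y).
Proof.
move=> xy; have [inv22 inv21] := fund_inv2 xy.
rewrite /lin_conn (split_sum s21) [X in _ * (_ + X)]big1 ?addr0.
  by apply: (congr1 ( *%R 2^-1)); apply: eq_bigr => e _; rewrite inv22.
by move=> e _; rewrite inv21 mul0r.
Qed.

(** The factor h2^2 is constant in the [s1] directions and cancels against its inverse. *)
Lemma warped_lin_conn111 (i j k : 'I_n1) (x y : 'rV[R]_n) : dom x y ->
  lin_conn F (s1 i) (s1 j) (s1 k) x y =
  lin_conn F1 i j k (subrow s1 x) (subrow s1 y).
Proof.
move=> xy; have [_ Ux2 _ _] := xy; rewrite (lin_conn_row1 _ _ _ xy).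
have c0 := h2_neq0 Ux2.
apply: (congr1 ( *%R 2^-1)); apply: eq_bigr => e _.
rewrite !(delta_d_fund11 _ _ _ xy).
have cancel (c v A B C : R) : c != 0 ->
    (c ^+ 2)^-1 * v * (c ^+ 2 * A + c ^+ 2 * B - c ^+ 2 * C) = v * (A + B - C).
  by move=> ?; field.
exact: cancel.
Qed.

(** Of the three derivatives only that of the first block in direction [s2 a] survives, and
    contracting it with the inverse metric gives the Kronecker symbol. *)
Lemma warped_lin_conn112 (i l : 'I_n1) (a : 'I_n2) (x y : 'rV[R]_n) :
  dom x y ->
  lin_conn F (s1 i) (s1 l) (s2 a) x y =
  (i == l)%:R * (dh2 a (subrow s2 x) / h2 (subrow s2 x)).
Proof.
move=> xy; have [Ux1 Ux2 y1 _] := xy; rewrite (lin_conn_row1 _ _ _ xy).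
have c0 := h2_neq0 Ux2.
have invE : \sum_e fund_inv F1 i e (subrow s1 x) (subrow s1 y) *
    fund F1 e l (subrow s1 x) (subrow s1 y) = (i == l)%:R.
  have /matrixP/(_ i l) := mulVmx (unitF1 Ux1 y1).
  rewrite !mxE => <-; apply: eq_bigr => e _.
  by congr (_ * _); rewrite mxE.
rewrite -invE mulr_suml mulr_sumr; apply: eq_bigr => e _.
rewrite (delta_d2_fund11 _ _ _ xy) !(delta_d_fund12 _ _ _ xy).
have cancel (c v D g : R) : c != 0 ->
    2^-1 * ((c ^+ 2)^-1 * v * (2 * c * D * g + 0 - 0)) = v * g * (D / c).
  by move=> ?; field.
exact: cancel.
Qed.

(** Only the subtracted derivative survives, hence the sign. F2 may be non-Riemannian: its inverse
    tensor can depend on the fibre, but this coefficient is never differentiated below. *)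
Lemma warped_lin_conn211 (a : 'I_n2) (j k : 'I_n1) (x y : 'rV[R]_n) :
  dom x y ->
  lin_conn F (s2 a) (s1 j) (s1 k) x y =
  - ((\sum_b fund_inv F2 a b (subrow s2 x) (subrow s2 y) *
       dh2 b (subrow s2 x)) *
     (h2 (subrow s2 x) * fund F1 j k (subrow s1 x) (subrow s1 y) /
      h1 (subrow s1 x) ^+ 2)).
Proof.
move=> xy; have [Ux1 Ux2 y1 _] := xy; rewrite (lin_conn_row2 _ _ _ xy).
have c0 := h1_neq0 Ux1.
rewrite mulr_suml mulr_sumr -sumrN; apply: eq_bigr => b _.
rewrite (delta_d2_fund11 _ _ _ xy) !(delta_d_fund21 _ _ _ xy).
have cancel (c d v D g : R) : c != 0 ->
    2^-1 * ((c ^+ 2)^-1 * v * (0 + 0 - 2 * d * D * g)) =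
    - (v * D * (d * g / c ^+ 2)).
  by move=> ?; field.
exact: cancel.
Qed.

(** The nonlinear connections of F and F1 may differ, but neither contributes, since these
    coefficients are constant along the fibres. *)
Lemma warped_delta_d_lin_conn (d i j k : 'I_n1) (x y : 'rV[R]_n) : dom x y ->
  delta_d F (s1 d) (lin_conn F (s1 i) (s1 j) (s1 k)) x y =
  delta_d F1 d (lin_conn F1 i j k) (subrow s1 x) (subrow s1 y).
Proof.
move=> xy; have [Ux1 Ux2 y1 y2] := xy.
rewrite (delta_d_lin_conn openU1 riemF1 _ _ _ _ Ux1 y1) delta_d_dpos => [|b].
  apply: derive_line.
  apply: filterS (warped_dom_pos openU1 openU2 (delta_mx 0 (s1 d)) xy) => t xyt.
  by rewrite (warped_lin_conn111 _ _ _ xyt) (subrow_line_in s12).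
apply: dfib_cst.
apply: filterS (warped_dom_fib (delta_mx 0 b) xy) => t xyt.
rewrite (warped_lin_conn111 _ _ _ xyt) (warped_lin_conn111 _ _ _ xy).
by have [_ _ yt _] := xyt; exact: (lin_conn_fib openU1 riemF1).
Qed.

Lemma warped_riem_curv (i j k l : 'I_n1) (x y : 'rV[R]_n) : dom x y ->
  riem_curv F (s1 i) (s1 j) (s1 k) (s1 l) x y =
  riem_curv F1 i j k l (subrow s1 x) (subrow s1 y) -
  (\sum_a \sum_b fund_inv F2 a b (subrow s2 x) (subrow s2 y) *
     dh2 a (subrow s2 x) * dh2 b (subrow s2 x)) / h1 (subrow s1 x) ^+ 2 *
  ((i == l)%:R * fund F1 j k (subrow s1 x) (subrow s1 y) -
   (i == k)%:R * fund F1 j l (subrow s1 x) (subrow s1 y)).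
Proof.
move=> xy; have [Ux1 Ux2 y1 y2] := xy.
have c1 := h1_neq0 Ux1; have c2 := h2_neq0 Ux2.
set N := \sum_a \sum_b _.
(* The correction comes only from summation indices [e] in the second block, where h2 cancels
   between the two coefficients. The cases (l, k) and (k, l) give the two quadratic terms of the
   curvature. *)
have quadE (l' k' : 'I_n1) :
    \sum_e lin_conn F (s1 i) (s1 l') e x y * lin_conn F e (s1 j) (s1 k') x y =
    \sum_e lin_conn F1 i l' e (subrow s1 x) (subrow s1 y) *
           lin_conn F1 e j k' (subrow s1 x) (subrow s1 y) -
    N / h1 (subrow s1 x) ^+ 2 *
    ((i == l')%:R * fund F1 j k' (subrow s1 x) (subrow s1 y)).
  rewrite (split_sum s12); congr (_ + _).
    apply: eq_bigr => e _.
    by rewrite !(warped_lin_conn111 _ _ _ xy).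
  rewrite /N -mulrA mulr_suml -sumrN; apply: eq_bigr => a _.
  rewrite (warped_lin_conn112 _ _ _ xy) (warped_lin_conn211 _ _ _ xy).
  have -> : \sum_b fund_inv F2 a b (subrow s2 x) (subrow s2 y) *
      dh2 a (subrow s2 x) * dh2 b (subrow s2 x) = dh2 a (subrow s2 x) *
      \sum_b fund_inv F2 a b (subrow s2 x) (subrow s2 y) * dh2 b (subrow s2 x).
    by rewrite mulr_sumr; apply: eq_bigr => b _; rewrite mulrCA mulrA.
  have cancel (c d e D S g : R) : c != 0 -> d != 0 ->
      e * (D / d) * - (S * (d * g / c ^+ 2)) =
      - (D * S * ((c ^+ 2)^-1 * (e * g))).
    by move=> ? ?; field; apply/andP.
  exact: cancel.
have collect (A B S T c p q A' B' S' T' : R) : A = A' -> B = B' ->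
    S = S' - c * p -> T = T' - c * q ->
    A - B + S - T = A' - B' + S' - T' - c * (p - q).
  by move=> -> -> -> ->; ring.
exact: (collect _ _ _ _ _ _ _ _ _ _ _ (warped_delta_d_lin_conn l i j k xy)
  (warped_delta_d_lin_conn k i j l xy) (quadE l k) (quadE k l)).
Qed.

End WarpedCurvature.

(** * From Finsler manifolds to coordinates, and the conclusion *)

Lemma finsler_fund_unit (R : realType) (n : nat) (M : manifold R n)
    (F : finsler M) (i : mindex M) (x y : 'rV[R]_n) :
  cimg (atlas i) x -> y != 0 -> fund_mx (in_coords F i) x y \in unitmx.
Proof.
(* A nonzero kernel vector would annul the positive definite form. *)
move=> Ux y0; rewrite -row_free_unit; apply/inj_row_free => w w0.
apply/eqP/contraT => wn0; have := fnorm_posdef F Ux y0 wn0.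
by rewrite w0 mul0mx mxE ltxx.
Qed.

Section DwpCoords.
Variables (R : realType) (n1 n2 : nat).
Variables (M1 : manifold R n1) (M2 : manifold R n2).
Variables (F1 : finsler M1) (F2 : finsler M2).
Variables (f1 : smooth_fun M1) (f2 : smooth_fun M2).
Variables (i1 : mindex M1) (i2 : mindex M2).

Lemma subrow_lshift (x : 'rV[R]_(n1 + n2)) :
  subrow (@lshift n1 n2) x = lsubmx x.
Proof. by apply/rowP => i; rewrite !mxE. Qed.

Lemma subrow_rshift (x : 'rV[R]_(n1 + n2)) :
  subrow (@rshift n1 n2) x = rsubmx x.
Proof. by apply/rowP => i; rewrite !mxE. Qed.

(** The radicand is a sum of products of squares, so the root disappears at all coordinates, even
    outside the charts. *)
Lemma sqr_dwp_coords (x y : 'rV[R]_(n1 + n2)) :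
  sqr_fld (dwp_coords F1 F2 f1 f2 i1 i2) x y =
  (f2 \o cinv (atlas i2)) (subrow (@rshift n1 n2) x) ^+ 2 *
    sqr_fld (in_coords F1 i1) (subrow (@lshift n1 n2) x)
      (subrow (@lshift n1 n2) y) +
  (f1 \o cinv (atlas i1)) (subrow (@lshift n1 n2) x) ^+ 2 *
    sqr_fld (in_coords F2 i2) (subrow (@rshift n1 n2) x)
      (subrow (@rshift n1 n2) y).
Proof.
rewrite !subrow_lshift !subrow_rshift /sqr_fld /dwp_coords /dwp sqr_sqrtr //.
by rewrite addr_ge0 // mulr_ge0 // sqr_ge0.
Qed.

End DwpCoords.

Theorem theorem4 (R : realType) (n1 n2 : nat)
    (M1 : manifold R n1) (M2 : manifold R n2)
    (F1 : finsler M1) (F2 : finsler M2)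
    (f1 : smooth_fun M1) (f2 : smooth_fun M2)
    (f1_gt0 : forall p : M1, 0 < f1 p) (f2_gt0 : forall p : M2, 0 < f2 p)
    (flat : dwp_flat F1 F2 f1 f2) :
  (riemannian F1 ->
   forall (i1 : mindex M1) (i2 : mindex M2)
     (x y : 'rV[R]_n1) (u v : 'rV[R]_n2),
     cimg (atlas i1) x -> cimg (atlas i2) u -> y != 0 -> v != 0 ->
     forall i j k l : 'I_n1,
       riem_curv (in_coords F1 i1) i j k l x y =
       grad_norm2 F2 f2 i2 u v / f1 (cinv (atlas i1) x) ^+ 2 *
       ((i == l)%:R * fund (in_coords F1 i1) j k x y
        - (i == k)%:R * fund (in_coords F1 i1) j l x y))
  /\
  (riemannian F2 ->
   forall (i1 : mindex M1) (i2 : mindex M2)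
     (x y : 'rV[R]_n1) (u v : 'rV[R]_n2),
     cimg (atlas i1) x -> cimg (atlas i2) u -> y != 0 -> v != 0 ->
     forall c a b l : 'I_n2,
       riem_curv (in_coords F2 i2) c a b l u v =
       grad_norm2 F1 f1 i1 x y / f2 (cinv (atlas i2) u) ^+ 2 *
       ((c == l)%:R * fund (in_coords F2 i2) a b u v
        - (c == b)%:R * fund (in_coords F2 i2) a l u v)).
Proof.
have s12 := index_split_ord R n1 n2.
have h1_neq0 i1 z : cimg (atlas i1) z -> (f1 \o cinv (atlas i1)) z != 0.
  by move=> _; rewrite /= gt_eqF.
have h2_neq0 i2 z : cimg (atlas i2) z -> (f2 \o cinv (atlas i2)) z != 0.
  by move=> _; rewrite /= gt_eqF.
split=> [riem1 | riem2] i1 i2 x y u v Ux Uu y0 v0 i j k l.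
  have dom : warped_dom (@lshift n1 n2) (@rshift n1 n2) (cimg (atlas i1))
      (cimg (atlas i2)) (row_mx x u) (row_mx y v).
    by rewrite /warped_dom !subrow_lshift !subrow_rshift !row_mxKl !row_mxKr.
  have := warped_riem_curv s12 (sqr_dwp_coords F1 F2 f1 f2 i1 i2)
    (@cimg_open _ _ _ (atlas i1)) (@cimg_open _ _ _ (atlas i2))
    (fnorm_smooth F1 i1) (fnorm_smooth F2 i2) (@finsler_fund_unit _ _ _ F1 i1)
    (@finsler_fund_unit _ _ _ F2 i2) (h1_neq0 i1) (h2_neq0 i2)
    (fun z w => @smooth_fun_derivable _ _ _ i2 z w f2) (riem1 i1) i j k l dom.
  (* Flatness makes the left side of the Gauss equation zero; the double sum on the right is
     [grad_norm2] unfolded. *)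
  rewrite (flat i1 i2 x y u v Ux Uu y0 v0) !subrow_lshift !subrow_rshift.
  rewrite !row_mxKl !row_mxKr => /esym/eqP; rewrite subr_eq0 => /eqP.
  exact.
(* For the second claim M2 takes the role of the first block. *)
have dom : warped_dom (@rshift n1 n2) (@lshift n1 n2) (cimg (atlas i2))
    (cimg (atlas i1)) (row_mx x u) (row_mx y v).
  by rewrite /warped_dom !subrow_lshift !subrow_rshift !row_mxKl !row_mxKr.
have := warped_riem_curv (index_splitC s12)
  (warped_sqrC (sqr_dwp_coords F1 F2 f1 f2 i1 i2))
  (@cimg_open _ _ _ (atlas i2)) (@cimg_open _ _ _ (atlas i1))
  (fnorm_smooth F2 i2) (fnorm_smooth F1 i1) (@finsler_fund_unit _ _ _ F2 i2)
  (@finsler_fund_unit _ _ _ F1 i1) (h2_neq0 i2) (h1_neq0 i1)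
  (fun z w => @smooth_fun_derivable _ _ _ i1 z w f1) (riem2 i2) i j k l dom.
rewrite (flat i1 i2 x y u v Ux Uu y0 v0) !subrow_lshift !subrow_rshift.
rewrite !row_mxKl !row_mxKr => /esym/eqP; rewrite subr_eq0 => /eqP.
exact.
Qed.
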